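(* Let $D$ be an integral domain and let $\star$ be an eab semistar operation on $D$. Then $\star_a$ is the unique semistar operation on $D$ which is eab (equivalently, ab), is of finite type, and is equivalent to $\star$.
   Context: Let $D$ be an integral domain with quotient field $K$. $\overline{\boldsymbol F}(D)$ is the set of all nonzero $D$-submodules of $K$, and $\boldsymbol f(D)$ is the set of all nonzero finitely generated fractional ideals of $D$. For $D$-submodules $A,B$ of $K$, $(A:B)=\{z\in K: zB\subseteq A\}$. A semistar operation of $D$ is a map $\star:\overline{\boldsymbol F}(D)\to\overline{\boldsymbol F}(D)$, $E\mapsto E^\star$, such that for all $0\ne z\in K$ and all $E,F\in\overline{\boldsymbol F}(D)$: $(zE)^\star=zE^\star$; $E\subseteq F$ implies $E^\star\subseteq F^\star$; $E\subseteq E^\star$ and $(E^\star)^\star=E^\star$. The semistar operation $\star_f$ is defined by $E^{\star_f}=\bigcup\{F^\star: F\in\boldsymbol f(D),\ F\subseteq E\}$; $\star$ is of finite type if $\star=\star_f$. $\star$ is eab if, for all $F,G,H\in\boldsymbol f(D)$, $(FG)^\star\subseteq(FH)^\star$ implies $G^\star\subseteq H^\star$; $\star$ is ab if the same implication holds for all $F\in\boldsymbol f(D)$ and all $G,H\in\overline{\boldsymbol F}(D)$. For semistar operations of finite type, eab and ab are equivalent. Two semistar operations $\star_1,\star_2$ on $D$ are equivalent if $F^{\star_1}=F^{\star_2}$ for every $F\in\boldsymbol f(D)$. The semistar operation $\star_a$ is defined by $F^{\star_a}=\bigcup\{((FH)^\star:H^\star): H\in\boldsymbol f(D)\}$ for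 $F\in\boldsymbol f(D)$, and $E^{\star_a}=\bigcup\{F^{\star_a}: F\in\boldsymbol f(D),\ F\subseteq E\}$ for $E\in\overline{\boldsymbol F}(D)$. *)

(* Defs.v *)
From mathcomp Require Import all_boot all_algebra.
From mathcomp Require Import boolp classical_sets.

Set Implicit Arguments.
Unset Strict Implicit.
Unset Printing Implicit Defensive.

Import GRing.Theory.
Local Open Scope ring_scope.
Local Open Scope classical_set_scope.

(* D is an integral domain and K := {fraction D} its quotient field.
   D-submodules of K are represented by their underlying subsets of K. *)

Section Submodules.
Context {D : idomainType}.
Local Notation K := {fraction D}.
Local Notation tofrac := (@FracField.tofrac D).
Implicit Types (A B E F G H : set K) (x y z : K).

Definition is_submod E : Prop :=
  [/\ E 0, (forall x y, E x -> E y -> E (x + y))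
    & forall (d : D) x, E x -> E (tofrac d * x)].

Definition Fbar E : Prop := is_submod E /\ exists2 x, E x & x != 0.

Definition is_fractional E : Prop :=
  exists2 d : D, d != 0 & forall x, E x -> exists a : D, tofrac d * x = tofrac a.

Definition is_fg E : Prop :=
  exists (n : nat) (g : 'I_n -> K),
    E = [set \sum_(i < n) tofrac (c i) * g i | c in [set: 'I_n -> D]].

Definition fgideal E : Prop := [/\ Fbar E, is_fractional E & is_fg E].

Definition scale z E : set K := [set z * x | x in E].

Definition prodm A B : set K :=
  [set x | exists2 s : seq (K * K),
     (forall p, p \in s -> A p.1 /\ B p.2) & x = \sum_(p <- s) p.1 * p.2].

Definition colon A B : set K := [set z | scale z B `<=` A].

(* A map Fbar(D) -> Fbar(D) is represented by a map on all subsets of K that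
   preserves Fbar; its values outside Fbar are irrelevant. *)
Record semistar (star : set K -> set K) : Prop := Semistar {
  semistar_Fbar : forall E, Fbar E -> Fbar (star E);
  semistar_scale : forall z E, z != 0 -> Fbar E ->
    star (scale z E) = scale z (star E);
  semistar_mono : forall E F, Fbar E -> Fbar F -> E `<=` F ->
    star E `<=` star F;
  semistar_ext : forall E, Fbar E -> E `<=` star E;
  semistar_idem : forall E, Fbar E -> star (star E) = star E
}.

Implicit Type star : set K -> set K.

Definition star_f star E : set K :=
  \bigcup_(F in [set F | fgideal F /\ F `<=` E]) star F.

Definition finite_type star : Prop :=
  forall E, Fbar E -> star E = star_f star E.

Definition eab star : Prop :=
  forall F G H, fgideal F -> fgideal G -> fgideal H ->
    star (prodm F G) `<=` star (prodm F H) -> star G `<=` star H.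

Definition ab star : Prop :=
  forall F G H, fgideal F -> Fbar G -> Fbar H ->
    star (prodm F G) `<=` star (prodm F H) -> star G `<=` star H.

Definition equivalent star1 star2 : Prop :=
  forall F, fgideal F -> star1 F = star2 F.

Definition star_a_fg star F : set K :=
  \bigcup_(H in fgideal) colon (star (prodm F H)) (star H).

(* star_a is defined by the formula for arbitrary E in Fbar(D); star_a_fgE
   below shows that it is given by star_a_fg on f(D). *)
Definition star_a star E : set K :=
  \bigcup_(F in [set F | fgideal F /\ F `<=` E]) star_a_fg star F.

Lemma prodm_Fbar A B : Fbar A -> Fbar B -> Fbar (prodm A B).
Proof.
move=> [[A0 AD AZ] [a Aa a0]] [_ [b Bb b0]]; split; first split.
- by exists [::] => //; rewrite big_nil.
- move=> _ _ [s hs ->] [t ht ->]; exists (s ++ t); last by rewrite big_cat.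
  by move=> p; rewrite mem_cat => /orP[/hs|/ht].
- move=> d _ [s hs ->]; exists [seq (tofrac d * p.1, p.2) | p <- s].
    by move=> _ /mapP[p /hs[Ap Bp] ->]; split=> //=; apply: AZ.
  by rewrite big_map mulr_sumr; apply: eq_bigr => p _; rewrite mulrA.
exists (a * b); last by rewrite mulf_neq0.
exists [:: (a, b)]; last by rewrite big_seq1.
by move=> p; rewrite inE => /eqP->.
Qed.

Lemma prodmSl A B E : A `<=` B -> prodm A E `<=` prodm B E.
Proof. by move=> AB x [s hs ->]; exists s => // p /hs[/AB]. Qed.

Lemma star_a_fgE star F :
  semistar star -> fgideal F -> star_a star F = star_a_fg star F.
Proof.
move=> hs hF; apply/seteqP; split=> [z [G [hG GF] [H hH hz]]|z hz]; last first.
  by exists F; [split|].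
exists H => // x /hz; case: hG hF hH => [? _ _] [? _ _] [? _ _].
by apply: semistar_mono => //; [exact: prodm_Fbar..|exact: prodmSl].
Qed.

End Submodules.

(* Main.v *)
Require Import Defs.
From mathcomp Require Import all_boot all_algebra.
From mathcomp Require Import boolp classical_sets.

(** For an eab operation the cancellation property gives
    ((FH)^star : H^star) = F^star for all finitely generated F and H, so star_a
    is the finite-type operation star_f, which agrees with star on f(D).  An
    operation of finite type is determined by its values on f(D); this gives
    uniqueness.  For finite type, eab implies ab: a finitely generated
    submodule of (FH)^star already lies in (FH')^star for some finitely
    generated H' contained in H. *)

Section FiniteType.
Import GRing.Theory.
Local Open Scope ring_scope.
Local Open Scope classical_set_scope.
Context {D : idomainType}.
Local Notation K := {fraction D}.
Local Notation tofrac := (@FracField.tofrac D).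
Implicit Types (A B E F G H : set K) (x y z : K) (s t : seq K).

(** * Spans of finite lists and finitely generated fractional ideals *)

Lemma fraction_denominator x :
  exists2 d : D, d != 0 & exists a : D, tofrac d * x = tofrac a.
Proof.
elim/quotW: x => r; exists (\d_r)%R; first exact: denom_ratioP.
exists (\n_r)%R; unlock FracField.tofrac.
(* Equality in the quotient becomes cross-multiplication of representatives. *)
rewrite -[LHS]FracField.pi_mul; apply/eqP.
rewrite FracField.equivf_def /FracField.mulf.
rewrite !numden_Ratio ?(oner_eq0, mulf_neq0, denom_ratioP) //.
by rewrite mulr1 mul1r.
Qed.

(** Encoded as an intersection of submodules, so that inclusions come from minimality and
    coefficients need not be handled. *)
Definition span s : set K :=
  [set x | forall E, is_submod E -> (forall y, y \in s -> E y) -> E x].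

Lemma span_submod s : is_submod (span s).
Proof.
split=> [E [E0 _ _] _ //|x y sx sy E hE sE|d x sx E hE sE].
  by case: (hE) => _ ED _; apply: ED; [apply: sx|apply: sy].
by case: (hE) => _ _ EZ; apply: EZ; apply: sx.
Qed.

Lemma mem_span s x : x \in s -> span s x.
Proof. by move=> xs E _ sE; apply: sE. Qed.

Lemma span_min s E :
  is_submod E -> (forall y, y \in s -> E y) -> span s `<=` E.
Proof. by move=> hE sE x sx; apply: sx. Qed.

Lemma span_subset s t : {subset s <= t} -> span s `<=` span t.
Proof.
by move=> st; apply: span_min; [exact: span_submod|move=> x /st/mem_span].
Qed.

Lemma submod_sum E (I : Type) (r : seq I) (P : pred I) (f : I -> K) :
  is_submod E -> (forall i, P i -> E (f i)) -> E (\sum_(i <- r | P i) f i).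
Proof. by case=> E0 ED _ Ef; apply: (big_ind E). Qed.

Lemma submod_sum_seq E (r : seq (K * K)) (f : K * K -> K) :
  is_submod E -> (forall p, p \in r -> E (f p)) -> E (\sum_(p <- r) f p).
Proof. by move=> hE Ef; rewrite big_seq; apply: submod_sum. Qed.

(** With [span_min], this reduces a membership [E (x * y)] for [y] in a span to the generators of
    that span. *)
Lemma submod_preimM E x : is_submod E -> is_submod [set y | E (x * y)].
Proof.
move=> [E0 ED EZ]; split=> [|y z|d y] /=; first by rewrite mulr0.
  by rewrite mulrDr; apply: ED.
by rewrite mulrCA; apply: EZ.
Qed.

Lemma submod_preimMr E x : is_submod E -> is_submod [set y | E (y * x)].
Proof.
move=> /(submod_preimM E x); congr is_submod.
by apply: eq_set => y; rewrite mulrC.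
Qed.

(** Bridge between the coefficient form in [is_fg] and [span]. *)
Lemma combination_span n (g : 'I_n -> K) :
  [set \sum_(i < n) tofrac (c i) * g i | c in [set: 'I_n -> D]]
  = span (codom g).
Proof.
apply/seteqP; split=> [_ [c _ <-]|].
  apply: submod_sum (span_submod _) _ => i _.
  case: (span_submod (codom g)) => _ _ spanZ; apply: spanZ; apply: mem_span.
  exact: codom_f.
apply: span_min => [|_ /codomP[i ->]].
  split=> [|_ _ [c _ <-] [e _ <-]|d _ [c _ <-]].
  - by exists (fun=> 0) => //; rewrite big1 // => i _; rewrite tofrac0 mul0r.
  - exists (fun i => c i + e i) => //; rewrite -big_split.
    by apply: eq_bigr => i _; rewrite tofracD mulrDl.
  - exists (fun i => d * c i) => //; rewrite mulr_sumr.
    by apply: eq_bigr => i _; rewrite tofracM mulrA.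
(* Kronecker delta coefficients single out the generator [g i]. *)
exists (fun j => (j == i)%:R) => //.
rewrite (bigD1 i) //= eqxx tofrac1 mul1r big1 ?addr0 // => j /negbTE->.
by rewrite tofrac0 mul0r.
Qed.

Lemma fgideal_is_span F : fgideal F -> exists s, F = span s.
Proof.
by move=> [_ _ [n [g ->]]]; exists (codom g); apply: combination_span.
Qed.

Lemma fgidealW F : fgideal F -> Fbar F. Proof. by case. Qed.

Lemma common_denominator s :
  exists2 d : D, d != 0 &
    forall x, x \in s -> exists a : D, tofrac d * x = tofrac a.
Proof.
elim: s => [|x s [d d0 ds]]; first by exists 1; [exact: oner_neq0|].
have [e e0 [a ea]] := fraction_denominator x.
exists (d * e) => [|y]; first exact: mulf_neq0.
rewrite inE => /predU1P[->|/ds[b db]].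
  by exists (d * a); rewrite !tofracM -mulrA ea.
by exists (e * b); rewrite !tofracM mulrAC db mulrC.
Qed.

(** A common denominator of the generators serves the whole span, so being fractional is automatic
    and only nonvanishing has to be assumed. *)
Lemma fgideal_span s x : span s x -> x != 0 -> fgideal (span s).
Proof.
move=> sx x0; split; first by split; [exact: span_submod|exists x].
  have [d d0 ds] := common_denominator s; exists d => // y.
  apply: (span_min s [set y | exists a, tofrac d * y = tofrac a]) => //.
  apply: (submod_preimM [set y | exists a, y = tofrac a]).
  split=> [|_ _ [a ->] [b ->]|e _ [a ->]].
  - by exists 0; rewrite tofrac0.
  - by exists (a + b); rewrite tofracD.
  - by exists (e * a); rewrite tofracM.
exists (size s), (tnth (in_tuple s)).
by rewrite combination_span codomE map_tnth_enum.
Qed.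

(** * Products and scalings of submodules *)

Lemma prodm_min A B E : is_submod E ->
  (forall x y, A x -> B y -> E (x * y)) -> prodm A B `<=` E.
Proof.
move=> hE ABE _ [r hr ->]; apply: submod_sum_seq => // p /hr[Ap Bp].
exact: ABE.
Qed.

Lemma mem_prodm A B x y : A x -> B y -> prodm A B (x * y).
Proof.
move=> Ax By; exists [:: (x, y)]; last by rewrite big_seq1.
by move=> p; rewrite inE => /eqP->.
Qed.

Lemma prodmC A B : Fbar A -> Fbar B -> prodm A B = prodm B A.
Proof.
have sub (A' B' : set K) : Fbar A' -> Fbar B' -> prodm A' B' `<=` prodm B' A'.
  move=> hA hB; apply: prodm_min; first by case: (prodm_Fbar hB hA).
  by move=> x y Ax By; rewrite mulrC; apply: mem_prodm.
by move=> hA hB; apply/seteqP; split; apply: sub.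
Qed.

Lemma prodmSr A E F : E `<=` F -> prodm A E `<=` prodm A F.
Proof. by move=> EF x [r hr ->]; exists r => // p /hr[? /EF]. Qed.

Lemma prodm_span s t : Fbar (span s) -> Fbar (span t) ->
  prodm (span s) (span t) = span [seq x * y | x <- s, y <- t].
Proof.
move=> hs ht; apply/seteqP; split.
  apply: prodm_min (span_submod _) _ => x y sx ty.
  apply: (span_min s _ (submod_preimMr _ y (span_submod _))) sx => a sa /=.
  apply: (span_min t _ (submod_preimM _ a (span_submod _))) ty => b tb /=.
  by apply: mem_span; apply/allpairsP; exists (a, b).
apply: span_min; first by case: (prodm_Fbar hs ht).
by move=> _ /allpairsP[[a b] /= [sa tb ->]]; apply: mem_prodm; apply: mem_span.
Qed.

Lemma fgideal_prodm F G : fgideal F -> fgideal G -> fgideal (prodm F G).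
Proof.
move=> hF hG; have [s Fs] := fgideal_is_span F hF.
have [t Gt] := fgideal_is_span G hG.
have [_ [x]] := prodm_Fbar (fgidealW F hF) (fgidealW G hG).
move: (fgidealW F hF) (fgidealW G hG); rewrite Fs Gt => hs ht.
by rewrite prodm_span //; apply: fgideal_span.
Qed.

Lemma fgideal_span1 z : z != 0 -> fgideal (span [:: z]).
Proof. by apply: fgideal_span; apply: mem_span; rewrite mem_head. Qed.

(** Closure properties of scalings thereby follow from those of products. *)
Lemma scale_span1 z E : is_submod E -> scale z E = prodm (span [:: z]) E.
Proof.
move=> hE; apply/seteqP; split=> [_ [x Ex <-]|].
  by apply: mem_prodm => //; apply: mem_span; rewrite mem_head.
case: (hE) => E0 ED EZ; have hzE : is_submod (scale z E).
  split=> [|_ _ [x Ex <-] [y Ey <-]|d _ [x Ex <-]].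
  - by exists 0; rewrite ?mulr0.
  - by exists (x + y); [apply: ED|rewrite mulrDr].
  - by exists (tofrac d * x); [apply: EZ|rewrite mulrCA].
apply: prodm_min => // x y zx Ey.
apply: (span_min [:: z] _ (submod_preimMr _ y hzE)) zx => a.
by rewrite inE => /eqP-> /=; exists y.
Qed.

Lemma fgideal_scale z F : z != 0 -> fgideal F -> fgideal (scale z F).
Proof.
move=> z0 hF; rewrite scale_span1; last by case: hF => [[]].
by apply: fgideal_prodm => //; apply: fgideal_span1.
Qed.

Lemma Fbar_scale z E : z != 0 -> Fbar E -> Fbar (scale z E).
Proof.
move=> z0 hE; rewrite scale_span1; last by case: hE.
by apply: prodm_Fbar => //; apply/fgidealW/fgideal_span1.
Qed.

Lemma scaleS z E F : E `<=` F -> scale z E `<=` scale z F.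
Proof. by move=> EF _ [x /EF Fx <-]; exists x. Qed.

Lemma scaleK z E : z != 0 -> scale z (scale z^-1 E) = E.
Proof.
move=> z0; apply/seteqP; split=> [_ [_ [x Ex <-] <-]|x Ex].
  by rewrite mulVKf.
by exists (z^-1 * x); [exists x|rewrite mulVKf].
Qed.

(** * The directed family of finitely generated ideals inside a submodule *)

Lemma fgideal_point E x : Fbar E -> E x ->
  exists F, [/\ fgideal F, F `<=` E & F x].
Proof.
(* The nonzero [y] keeps the span nonzero when [x] is 0. *)
move=> [hE [y Ey y0]] Ex; exists (span [:: x; y]); split.
- by apply: (fgideal_span _ y) => //; apply: mem_span; rewrite !inE eqxx orbT.
- by apply: span_min => // z; rewrite !inE => /orP[]/eqP->.
- by apply: mem_span; rewrite mem_head.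
Qed.

Lemma fgideal_directed E F G : is_submod E ->
  fgideal F -> fgideal G -> F `<=` E -> G `<=` E ->
  exists H, [/\ fgideal H, H `<=` E, F `<=` H & G `<=` H].
Proof.
move=> hE hF hG; case: (fgidealW F hF) => _ [x + x0].
have [s ->] := fgideal_is_span F hF; have [t ->] := fgideal_is_span G hG.
move=> sx sE tE; exists (span (s ++ t)).
have st : span s `<=` span (s ++ t).
  by apply: span_subset => y ys; rewrite mem_cat ys.
split=> //.
- exact: fgideal_span (st x sx) x0.
- apply: span_min => // y; rewrite mem_cat.
  by case/orP=> /mem_span; [apply: sE|apply: tE].
- by apply: span_subset => y yt; rewrite mem_cat yt orbT.
Qed.

(** By directedness and monotonicity, finitely many witnesses merge into one. It is applied with [P]
    equal to [star], [prodm F] and [id]. *)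
Lemma fgideal_cover (P : set K -> set K) E s :
    (forall F G, fgideal F -> fgideal G -> F `<=` G -> P F `<=` P G) ->
    Fbar E ->
    (forall x, x \in s -> exists F, [/\ fgideal F, F `<=` E & P F x]) ->
  exists F, [/\ fgideal F, F `<=` E & forall x, x \in s -> P F x].
Proof.
move=> monoP hE; elim: s => [|x s IHs] hs.
  case: (hE) => _ [x Ex _]; have [F [hF FE _]] := fgideal_point E x hE Ex.
  by exists F.
have [y ys|F [hF FE Fs]] := IHs; first by apply: hs; rewrite inE ys orbT.
have [|G [hG GE Gx]] := hs x; first exact: mem_head.
have [H [hH HE FH GH]] := fgideal_directed E F G (proj1 hE) hF hG FE GE.
exists H; split=> // y; rewrite inE => /predU1P[->|/Fs].
  exact: monoP Gx.
exact: monoP.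
Qed.

(** * The finite-type operation [star_f] *)

Section Star.
Variable star : set K -> set K.
Hypothesis hs : semistar star.

Let star_submod E : Fbar E -> is_submod (star E).
Proof. by case/(semistar_Fbar hs). Qed.

Lemma star_le E F : Fbar E -> Fbar F -> E `<=` star F -> star E `<=` star F.
Proof.
move=> hE hF EF; rewrite -[X in _ `<=` X](semistar_idem hs) //.
by apply: (semistar_mono hs) => //; apply: (semistar_Fbar hs).
Qed.

Lemma star_f_fgideal F : fgideal F -> star_f star F = star F.
Proof.
move=> hF; apply/seteqP; split=> [x [G [hG GF]]|x Fx]; last first.
  by exists F; [split|].
by apply: (semistar_mono hs) => //; apply: fgidealW.
Qed.

Lemma star_fS E F : E `<=` F -> star_f star E `<=` star_f star F.
Proof.
by move=> EF x [G [hG GE] Gx]; exists G => //; split=> // y /GE/EF.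
Qed.

(** Each of the finitely many generators of [F] lies in some [star G]; these [G] merge into one. *)
Lemma fgideal_sub_star_f E F : Fbar E -> fgideal F -> F `<=` star_f star E ->
  exists G, [/\ fgideal G, G `<=` E & F `<=` star G].
Proof.
move=> hE hF; have [s ->] := fgideal_is_span F hF => sE.
have [|//||G [hG GE Gs]] := fgideal_cover star E s.
- by move=> F1 F2 /fgidealW h1 /fgidealW h2; apply: (semistar_mono hs).
- by move=> x /mem_span/sE[G [hG GE] Gx]; exists G.
by exists G; split=> //; apply: span_min => //;
  apply: star_submod; apply: fgidealW.
Qed.

Lemma star_f_ext E : Fbar E -> E `<=` star_f star E.
Proof.
move=> hE x Ex; have [F [hF FE Fx]] := fgideal_point E x hE Ex.
by exists F => //; apply: (semistar_ext hs) => //; apply: fgidealW.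
Qed.

Lemma star_f_Fbar E : Fbar E -> Fbar (star_f star E).
Proof.
move=> hE; case: (hE) => [hE1 [x Ex x0]].
split; last by exists x => //; apply: star_f_ext.
split.
- by apply: star_f_ext => //; case: hE1.
- move=> y z [F [hF FE] Fy] [G [hG GE] Gz].
  have [H [hH HE FH GH]] := fgideal_directed E F G hE1 hF hG FE GE.
  exists H => //; case: (star_submod H (fgidealW H hH)) => _ HD _.
  by apply: HD; [move: Fy|move: Gz]; apply: (semistar_mono hs) => //;
    apply: fgidealW.
- move=> d y [F [hF FE] Fy]; exists F => //.
  by case: (star_submod F (fgidealW F hF)) => _ _ FZ; apply: FZ.
Qed.

Lemma scale_star_f z E : z != 0 ->
  scale z (star_f star E) `<=` star_f star (scale z E).
Proof.
move=> z0 _ [x [F [hF FE] Fx] <-]; exists (scale z F).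
  by split; [apply: fgideal_scale|apply: scaleS].
by rewrite (semistar_scale hs) //; [exists x|apply: fgidealW].
Qed.

Lemma star_f_semistar : semistar (star_f star).
Proof.
split.
- exact: star_f_Fbar.
- move=> z E z0 hE; apply/seteqP; split; last exact: scale_star_f.
  (* The reverse inclusion is [scale_star_f] for the scalar [z^-1] and the module [scale z E]. *)
  rewrite -[X in X `<=` _](scaleK z _ z0); apply: scaleS.
  rewrite -[X in _ `<=` star_f star X](scaleK z^-1 E) ?invr_eq0 // invrK.
  by apply: scale_star_f; rewrite invr_eq0.
- by move=> E F _ _; apply: star_fS.
- exact: star_f_ext.
- move=> E hE; apply/seteqP; split; last exact/star_f_ext/star_f_Fbar.
  move=> x [F [hF FE] Fx].
  (* A single [G] has [F] inside [star G], so [star F] is inside [star G] by idempotence of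
     [star]. *)
  have [G [hG GE FG]] := fgideal_sub_star_f E F hE hF FE.
  by exists G => //; move: Fx; apply: star_le => //; apply: fgidealW.
Qed.

(** * Equivalence of eab and ab in finite type *)

Lemma fgideal_sub_prodm F H L : fgideal F -> Fbar H -> fgideal L ->
  L `<=` prodm F H -> exists G, [/\ fgideal G, G `<=` H & L `<=` prodm F G].
Proof.
move=> hF hH hL; have [s ->] := fgideal_is_span L hL => sFH.
have [F1 F2 _ _|//|x /mem_span/sFH[r hr ->]|G [hG GH Gs]] :=
  fgideal_cover (prodm F) H s.
- exact: prodmSr.
(* A generator [x] of [L] is a finite sum of products; the second factors occurring in it lie in one
   finitely generated [G] inside [H]. *)
- have [F1 F2 _ _ //|//|y /mapP[p /hr[_ Hp] ->]|G [hG GH Gr]] :=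
    fgideal_cover id H [seq p.2 | p <- r].
    exact: fgideal_point.
  exists G; split=> //; exists r => // p pr; split; first by case: (hr p pr).
  exact/Gr/map_f.
exists G; split=> //; apply: span_min => //.
by case: (prodm_Fbar (fgidealW F hF) (fgidealW G hG)).
Qed.

Lemma eab_ab : finite_type star -> eab star -> ab star.
Proof.
move=> ft heab F G H hF hG hH FGH x; rewrite ft // => -[G0 [hG0 G0G] G0x].
have FG0 := fgideal_prodm F G0 hF hG0.
have hFH := prodm_Fbar (fgidealW F hF) hH.
have hFG := prodm_Fbar (fgidealW F hF) hG.
have [y y0|L [hL LFH FG0L]] := fgideal_sub_star_f (prodm F H) _ hFH FG0.
  rewrite -ft //; apply/FGH/(semistar_ext hs) => //.
  exact: prodmSr y0.
have [H0 [hH0 H0H LFH0]] := fgideal_sub_prodm F H L hF hH hL LFH.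
have FH0 := fgideal_prodm F H0 hF hH0.
(* Here [F G0] lies in [star L], hence in [star (F H0)], and eab cancels [F] since [G0] and [H0] are
   finitely generated. *)
have : star G0 `<=` star H0.
  apply: (heab F) => //; apply: star_le; try exact: fgidealW.
  move=> y /FG0L; apply: (semistar_mono hs) => //; exact: fgidealW.
move=> /(_ x G0x); apply: (semistar_mono hs) => //; exact: fgidealW.
Qed.

Lemma ab_eab : ab star -> eab star.
Proof. by move=> hab F G H hF /fgidealW hG /fgidealW; apply: hab. Qed.

(** * The operation [star_a] of an eab operation *)

Hypothesis heab : eab star.

(** If [z] is nonzero and carries [star H] into [star (F H)], then [H (z)] lies in [star (H F)], and
    cancelling [H] puts [z] in [star F]. For the converse, [H] is the unit ideal. *)
Lemma star_a_fg_eab F : fgideal F -> star_a_fg star F = star F.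
Proof.
move=> hF; have hFb := fgidealW F hF; have hS := star_submod F hFb.
apply/seteqP; split=> z.
  (* The case 0 is separate because [span [:: 0]] is not in [Fbar]. *)
  have [-> _|z0] := eqVneq z 0; first by case: hS.
  move=> [H hH Hz]; have hHb := fgidealW H hH.
  have hzf := fgideal_span1 z z0; have hz := fgidealW _ hzf.
  suff : star (span [:: z]) `<=` star F.
    move=> zF; apply: zF; apply: (semistar_ext hs) => //.
    by apply: mem_span; rewrite mem_head.
  apply: (heab H) => //; rewrite [X in _ `<=` star X]prodmC //.
  have hFH := prodm_Fbar hFb hHb.
  apply: star_le => //; first exact: prodm_Fbar.
  apply: prodm_min => [|x y Hx]; first exact: star_submod.
  apply: (span_min [:: z] _ (submod_preimM _ x (star_submod _ hFH))) => a.
  rewrite inE => /eqP-> /=; apply: Hz; exists x; last exact: mulrC.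
  exact: (semistar_ext hs).
have h1f := fgideal_span1 1 (oner_neq0 K); have h1 := fgidealW _ h1f.
have hF1 := prodm_Fbar hFb h1.
move=> Fz; exists (span [:: 1]) => //.
have [->|z0] := eqVneq z 0.
  by move=> _ [x _ <-]; rewrite mul0r; case: (star_submod _ hF1).
(* Moving [z] under [star] leaves [star (z D)] inside [star (F D)], which holds because [z D] lies
   in [star F] and [F] in [F D]. *)
rewrite /colon /= -(semistar_scale hs) //.
have : star (scale z (span [:: 1])) `<=` star F.
  apply: star_le => //; first exact: Fbar_scale.
  move=> _ [x + <-]; apply: span_min (submod_preimM _ z hS) _ x => y.
  by rewrite inE => /eqP-> /=; rewrite mulr1.
move=> /subset_trans; apply; apply: (semistar_mono hs) => // x Fx.
by rewrite -[x]mulr1; apply: mem_prodm => //; apply: mem_span; rewrite mem_head.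
Qed.

Lemma star_a_eab : star_a star = star_f star.
Proof.
apply/funext => E; apply/seteqP; split=> x [F [hF FE] Fx].
  by exists F => //; rewrite -star_a_fg_eab.
by exists F => //; rewrite star_a_fg_eab.
Qed.

Lemma star_f_eab : eab (star_f star).
Proof.
move=> F G H hF hG hH; rewrite !star_f_fgideal //; try exact: fgideal_prodm.
exact: heab.
Qed.

End Star.

(** The union defining [star_f] uses only values on finitely generated ideals. This is the source of
    uniqueness. *)
Lemma eq_star_f (star1 star2 : set K -> set K) :
  equivalent star1 star2 -> star_f star1 = star_f star2.
Proof.
move=> e12; apply/funext => E.
by apply/seteqP; split=> x [F [hF FE] Fx]; exists F => //; rewrite ?e12 // -e12.
Qed.

End FiniteType.

Theorem mainTheorem1 (D : idomainType)
    (star : set {fraction D} -> set {fraction D})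
    (star_semistar : semistar star) (star_eab : eab star) :
  [/\ semistar (star_a star), eab (star_a star), finite_type (star_a star)
    & equivalent (star_a star) star]
  /\ (forall star' : set {fraction D} -> set {fraction D},
        semistar star' -> eab star' -> finite_type star' ->
        equivalent star' star ->
        forall E : set {fraction D}, Fbar E -> star' E = star_a star E)
  /\ (forall star' : set {fraction D} -> set {fraction D},
        semistar star' -> finite_type star' -> (eab star' <-> ab star')).
Proof.
have equiv_f : equivalent (star_f star) star by move=> F; apply: star_f_fgideal.
rewrite (star_a_eab star star_semistar star_eab); split; last split.
- split=> //; first exact: star_f_semistar.
    exact: star_f_eab.
  (* Since [star_f star] is equivalent to [star], applying [star_f] twice changes nothing. *)
  by move=> E _; rewrite (eq_star_f _ _ equiv_f).
- by move=> star' _ _ ft' equiv' E hE; rewrite ft' // (eq_star_f _ _ equiv').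
- move=> star' hs' ft'; split; first exact: eab_ab.
  exact: ab_eab.
Qed.
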